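(* Let $R$ be a commutative ring, $T$ an $R$-algebra, $S$ a semigroup with zero, and $f:\overline{RS}\to T$ an $R$-linear function. (1) The map $f$ is a trace if and only if $s\sim_p t$ implies that $f(s)=f(t)$ for all $s,t\in S$. (2) Suppose that $f$ is a minimal trace. Then $s\sim_p t$ if and only if $f(s)=f(t)$, for all $s,t\in S$.
   Context: All rings are assumed to be unital. $\overline{RS}$ denotes the contracted semigroup ring, i.e., the quotient of the semigroup ring $RS$ by the ideal $\{x\cdot 0_S\mid x\in R\}$ generated by the zero $0_S$ of $S$ (so that the zero of $S$ is identified with the zero of $RS$); an arbitrary element of $\overline{RS}$ can be represented as $\sum_{s\in S\setminus\{0\}}a_s s$, where $a_s\in R$ and all but finitely many of the $a_s$ are zero. Elements of $S$ are regarded as elements of $\overline{RS}$. An additive function $f:A\to T$ between $R$-algebras is $R$-linear if $f(rx)=rf(x)$ for all $x\in A$ and $r\in R$. An additive function $f:A\to T$ between rings is a ($T$-valued) trace on $A$ if $f(xy)=f(yx)$ for all $x,y\in A$; a trace $f$ on $A$ is minimal if, for all $x\in A$, $f(x)=0$ implies that $x$ is a sum of additive commutators $yz-zy$ ($y,z\in A$). For a semigroup $S$, $S^1$ denotes the monoid obtained by adjoining an identity element $1$ to $S$; if $S$ is itself a monoid, $S^1=S$. For $s,t\in S$, $s\sim_p^1 t$ means that there exist $p,r\in S^1$ with $s=pr$ and $t=rp$; $\sim_p$ is the transitive closure of $\sim_p^1$.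
   Formalization: The ring R (and the algebra T) is assumed nonzero; for R = 0 part (2) fails, e.g. S = {0,1} with f = 0, a minimal trace with f(0) = f(1) although 0 and 1 are not related by ~_p. *)

(* Defs.v *)
From HB Require Import structures.
From mathcomp Require Import all_boot all_order all_algebra finmap.
From mathcomp.multinomials Require Import monalg.
From Stdlib Require Import Relation_Operators.

Set Implicit Arguments.
Unset Strict Implicit.
Unset Printing Implicit Defensive.

Import GRing.Theory.
Local Open Scope quotient_scope.
Local Open Scope fset_scope.
Local Open Scope ring_scope.

HB.mixin Record Semigroup_hasZero S of Semigroup S := {
  szero : S;
  smul0g : forall s : S, (szero * s)%g = szero;
  smulg0 : forall s : S, (s * szero)%g = szero
}.

#[short(type="semigroup0Type")]
HB.structure Definition Semigroup0 := {S of Semigroup_hasZero S & Semigroup S}.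

(* Rings without the requirement of an identity element (a semigroup ring has  *)
(* none in general). The product is that of the underlying semigroup, x * y in *)
(* group_scope.                                                                *)
HB.mixin Record Zmodule_isRng A of GRing.Zmodule A & Semigroup A := {
  rngDl : forall x y z : A, ((x + y)%R * z)%g = (x * z)%g + (y * z)%g;
  rngDr : forall x y z : A, (x * (y + z)%R)%g = (x * y)%g + (x * z)%g
}.

#[short(type="rngType")]
HB.structure Definition Rng :=
  {A of Zmodule_isRng A & GRing.Zmodule A & Semigroup A}.

Section Traces.
Variables (A : rngType) (T : zmodType).

Definition is_trace (f : {additive A -> T}) : Prop :=
  forall x y : A, f (x * y)%g = f (y * x)%g.

Definition sum_of_commutators (x : A) : Prop :=
  exists s : seq (A * A), x = \sum_(p <- s) ((p.1 * p.2)%g - (p.2 * p.1)%g).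

Definition is_minimal_trace (f : {additive A -> T}) : Prop :=
  is_trace f /\ (forall x : A, f x = 0 -> sum_of_commutators x).
End Traces.

Section Conjugacy.
Variable S : semigroupType.

Definition has_identity : Prop :=
  exists e : S, forall s : S, (e * s)%g = s /\ (s * e)%g = s.

(* S^1 as a subset of option S, None being the adjoined identity: it is all of *)
(* option S, unless S is already a monoid, in which case it is S.              *)
Definition in_S1 (x : option S) : Prop := x = None -> ~ has_identity.

Definition mulS1 (x y : option S) : option S :=
  match x, y with
  | Some s, Some t => Some (s * t)%g
  | Some s, None => Some s
  | None, _ => y
  end.

Definition conj_p1 (s t : S) : Prop :=
  exists p r : option S,
    [/\ in_S1 p, in_S1 r, Some s = mulS1 p r & Some t = mulS1 r p].

Definition conj_p : S -> S -> Prop := clos_trans S conj_p1.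
End Conjugacy.

Section SemigroupRing.
Variables (R : comNzRingType) (S : semigroupType).
Local Notation RS := {malg R[S]}.

Definition sgmul (g h : RS) : RS :=
  \sum_(s <- msupp g) \sum_(t <- msupp h) << g@_s * h@_t *g (s * t)%g >>.

Lemma sgmulw (d1 d2 : {fset S}) (g h : RS) :
  msupp g `<=` d1 -> msupp h `<=` d2 ->
  sgmul g h = \sum_(s <- d1) \sum_(t <- d2) << g@_s * h@_t *g (s * t)%g >>.
Proof.
move=> le1 le2; rewrite /sgmul (big_fset_incl _ le1) /=.
  apply/eq_bigr=> s _; apply/big_fset_incl => // t _ /mcoeff_outdom ->.
  by rewrite mulr0 monalgU0.
by move=> s _ /mcoeff_outdom gs; rewrite big1 => // t _; rewrite gs mul0r monalgU0.
Qed.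

Lemma sgmulDl : left_distributive sgmul +%R.
Proof.
move=> g1 g2 g.
rewrite [sgmul g1 _](sgmulw (fsubsetUl _ (msupp g2)) (fsubset_refl (msupp g))).
rewrite [sgmul g2 _](sgmulw (fsubsetUr (msupp g1) _) (fsubset_refl (msupp g))).
rewrite (sgmulw (msuppD_le g1 g2) (fsubset_refl (msupp g))).
rewrite -big_split /=; apply/eq_bigr=> s _.
rewrite -big_split /=; apply/eq_bigr=> t _.
by rewrite mcoeffD mulrDl monalgUD.
Qed.

Lemma sgmulDr : right_distributive sgmul +%R.
Proof.
move=> g g1 g2.
rewrite [sgmul _ g1](sgmulw (fsubset_refl (msupp g)) (fsubsetUl _ (msupp g2))).
rewrite [sgmul _ g2](sgmulw (fsubset_refl (msupp g)) (fsubsetUr (msupp g1) _)).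
rewrite (sgmulw (fsubset_refl (msupp g)) (msuppD_le g1 g2)).
rewrite -big_split /=; apply/eq_bigr=> s _.
rewrite -big_split /=; apply/eq_bigr=> t _.
by rewrite mcoeffD mulrDr monalgUD.
Qed.

Lemma sgmulUU (a b : R) (s t : S) :
  sgmul << a *g s >> << b *g t >> = << a * b *g (s * t)%g >>.
Proof. by rewrite (sgmulw msuppU_le msuppU_le) !big_seq_fset1 !mcoeffUU. Qed.

Lemma sgmul0g : left_zero 0 sgmul.
Proof. by move=> g; apply: (addIr (sgmul 0 g)); rewrite -sgmulDl !add0r. Qed.

Lemma sgmulg0 : right_zero 0 sgmul.
Proof. by move=> g; apply: (addIr (sgmul g 0)); rewrite -sgmulDr !add0r. Qed.

Lemma sgmul_suml I (r : seq I) (F : I -> RS) h :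
  sgmul (\sum_(i <- r) F i) h = \sum_(i <- r) sgmul (F i) h.
Proof. exact: (big_morph (sgmul^~ h) (fun _ _ => sgmulDl _ _ _) (sgmul0g _)). Qed.

Lemma sgmul_sumr I (r : seq I) (F : I -> RS) h :
  sgmul h (\sum_(i <- r) F i) = \sum_(i <- r) sgmul h (F i).
Proof. exact: (big_morph (sgmul h) (fun _ _ => sgmulDr _ _ _) (sgmulg0 _)). Qed.

Lemma sgmulA : associative sgmul.
Proof.
move=> g1 g2 g3; rewrite [g1]monalgE !sgmul_suml; apply/eq_bigr=> s _.
rewrite [g2]monalgE sgmul_suml !sgmul_sumr sgmul_suml; apply/eq_bigr=> t _.
rewrite [g3]monalgE !sgmul_sumr; apply/eq_bigr=> u _.
by rewrite !sgmulUU mulrA mulgA.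
Qed.

Lemma sgscaleU (a b : R) (s : S) : a *: << b *g s >> = << a * b *g s >> :> RS.
Proof. by apply/malgP=> k; rewrite mcoeffZ !mcoeffU mulrnAr. Qed.

Lemma sgscaleAl a (g h : RS) : a *: sgmul g h = sgmul (a *: g) h.
Proof.
rewrite [g]monalgE [in RHS]scaler_sumr !sgmul_suml [LHS]scaler_sumr; apply/eq_bigr=> s _.
rewrite [h]monalgE !sgmul_sumr [LHS]scaler_sumr; apply/eq_bigr=> t _.
by rewrite sgscaleU !sgmulUU sgscaleU mulrA.
Qed.

Lemma sgscaleAr a (g h : RS) : a *: sgmul g h = sgmul g (a *: h).
Proof.
rewrite [g]monalgE !sgmul_suml [LHS]scaler_sumr; apply/eq_bigr=> s _.
rewrite [h]monalgE [in RHS]scaler_sumr !sgmul_sumr [LHS]scaler_sumr; apply/eq_bigr=> t _.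
by rewrite sgscaleU !sgmulUU sgscaleU mulrCA.
Qed.

End SemigroupRing.

(* The semigroup ring RS: finitely supported functions S -> R, with << x *g s >> *)
(* standing for x s. (The library puts a product on {malg R[S]} only for         *)
(* monoids S without nontrivial units.)                                          *)
Definition sgring (R : comNzRingType) (S : semigroupType) : Type := {malg R[S]}.

HB.instance Definition _ (R : comNzRingType) (S : semigroupType) :=
  GRing.Lmodule.on (sgring R S).
HB.instance Definition _ (R : comNzRingType) (S : semigroupType) :=
  isSemigroup.Build (sgring R S) (@sgmulA R S).
HB.instance Definition _ (R : comNzRingType) (S : semigroupType) :=
  Zmodule_isRng.Build (sgring R S) (@sgmulDl R S) (@sgmulDr R S).

Section Contracted.
Variables (R : comNzRingType) (S : semigroup0Type).
Local Notation RS := (sgring R S).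
Local Notation z := (szero : S).

Definition zero_ideal (g : RS) : bool := g == << g@_z *g z >>.

Lemma zero_idealP (g : RS) :
  reflect (exists x : R, g = << x *g z >>) (g \in zero_ideal).
Proof.
apply: (iffP eqP) => [e|[x ->]]; last by rewrite mcoeffUU.
by exists g@_z.
Qed.

Lemma zero_ideal_zmod : zmod_closed zero_ideal.
Proof.
split=> [|g h /zero_idealP[x ->] /zero_idealP[y ->]]; apply/zero_idealP.
  by exists 0; rewrite monalgU0.
by exists (x - y); rewrite monalgUB.
Qed.

HB.instance Definition _ := GRing.isZmodClosed.Build RS zero_ideal zero_ideal_zmod.

Lemma zero_idealZ (a : R) (g : RS) : g \in zero_ideal -> a *: g \in zero_ideal.
Proof.
by case/zero_idealP=> x ->; apply/zero_idealP; exists (a * x); rewrite sgscaleU.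
Qed.

Lemma zero_idealMl (g h : RS) : h \in zero_ideal -> (g * h)%g \in zero_ideal.
Proof.
case/zero_idealP=> x ->; rewrite [g]monalgE [X in X \in _]sgmul_suml.
apply: rpred_sum => s _; rewrite sgmulUU smulg0.
by apply/zero_idealP; exists (g@_s * x).
Qed.

Lemma zero_idealMr (g h : RS) : g \in zero_ideal -> (g * h)%g \in zero_ideal.
Proof.
case/zero_idealP=> x ->; rewrite [h]monalgE [X in X \in _]sgmul_sumr.
apply: rpred_sum => s _; rewrite sgmulUU smul0g.
by apply/zero_idealP; exists (x * h@_s).
Qed.

Local Notation I0 := (GRing.ZmodClosed.clone RS zero_ideal _).

Definition contracted : Type := {ideal_quot I0}.

HB.instance Definition _ := GRing.Zmodule.on contracted.
HB.instance Definition _ : EqQuotient RS (Quotient.equiv I0) contracted :=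
  EqQuotient.on contracted.

Local Notation pi := (\pi_contracted : RS -> contracted).

Lemma pi_contrP (g h : RS) : (pi g = pi h) <-> (g - h \in zero_ideal).
Proof. by rewrite Quotient.idealrBE; split=> [e|/eqP//]; apply/eqP. Qed.

Lemma pi_contrD (g h : RS) : pi (g + h) = pi g + pi h.
Proof. exact: Quotient.pi_add. Qed.

Lemma pi_contr0 : pi 0 = 0.
Proof. by apply: (addIr (pi 0)); rewrite -pi_contrD !add0r. Qed.

Definition cscale (a : R) (x : contracted) : contracted := pi (a *: repr x).
Definition cmul (x y : contracted) : contracted := pi (repr x * repr y)%g.

Lemma pi_contrZ (a : R) (g : RS) : pi (a *: g) = cscale a (pi g).
Proof.
apply/pi_contrP; rewrite -scalerBr; apply: zero_idealZ.
by apply/pi_contrP; rewrite reprK.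
Qed.

Lemma pi_contrM (g h : RS) : pi (g * h)%g = cmul (pi g) (pi h).
Proof.
pose g' := repr (pi g); pose h' := repr (pi h).
have Eg : g - g' \in zero_ideal by apply/pi_contrP; rewrite reprK.
have Eh : h - h' \in zero_ideal by apply/pi_contrP; rewrite reprK.
apply/pi_contrP; rewrite -/g' -/h'.
have -> : (g * h)%g - (g' * h')%g = ((g - g') * h)%g + (g' * (h - h'))%g :> RS.
  have dl : ((g - g') * h)%g = (g * h)%g - (g' * h)%g :> RS.
    by apply/(addIr (g' * h)%g); rewrite -rngDl !subrK.
  have dr : (g' * (h - h'))%g = (g' * h)%g - (g' * h')%g :> RS.
    by apply/(addIr (g' * h')%g); rewrite -rngDr !subrK.
  by rewrite dl dr addrA subrK.
by apply: rpredD; [apply: zero_idealMr | apply: zero_idealMl].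
Qed.

Lemma contrW (P : contracted -> Prop) : (forall g, P (pi g)) -> forall x, P x.
Proof. by move=> H x; rewrite -[x]reprK. Qed.

Lemma cscaleA a b x : cscale a (cscale b x) = cscale (a * b) x.
Proof.
elim/contrW: x => g.
by rewrite -(pi_contrZ b g) -(pi_contrZ a (b *: g)) -(pi_contrZ (a * b) g) scalerA.
Qed.

Lemma cscale1 : left_id 1 cscale.
Proof. by elim/contrW=> g; rewrite -(pi_contrZ 1 g) scale1r. Qed.

Lemma cscaleDr : right_distributive cscale +%R.
Proof.
move=> a; elim/contrW=> g; elim/contrW=> h.
by rewrite -pi_contrD -(pi_contrZ a g) -(pi_contrZ a h) -(pi_contrZ a (g + h))
  scalerDr pi_contrD.
Qed.

Lemma cscaleDl x : {morph cscale^~ x : a b / a + b}.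
Proof.
elim/contrW: x => g a b.
by rewrite -(pi_contrZ a g) -(pi_contrZ b g) -(pi_contrZ (a + b) g)
  scalerDl pi_contrD.
Qed.

HB.instance Definition _ :=
  GRing.Zmodule_isLmodule.Build R contracted cscaleA cscale1 cscaleDr cscaleDl.

Lemma cmulA : associative cmul.
Proof.
elim/contrW=> g; elim/contrW=> h; elim/contrW=> k.
by rewrite -(pi_contrM g h) -(pi_contrM h k) -(pi_contrM g (h * k)%g)
  -(pi_contrM (g * h)%g k) mulgA.
Qed.

Lemma cmulDl x y t : cmul (x + y) t = cmul x t + cmul y t.
Proof.
elim/contrW: x => g; elim/contrW: y => h; elim/contrW: t => k.
by rewrite -pi_contrD -(pi_contrM g k) -(pi_contrM h k) -(pi_contrM (g + h) k)
  rngDl pi_contrD.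
Qed.

Lemma cmulDr x y t : cmul x (y + t) = cmul x y + cmul x t.
Proof.
elim/contrW: x => g; elim/contrW: y => h; elim/contrW: t => k.
by rewrite -pi_contrD -(pi_contrM g h) -(pi_contrM g k) -(pi_contrM g (h + k))
  rngDr pi_contrD.
Qed.

HB.instance Definition _ := isSemigroup.Build contracted cmulA.
HB.instance Definition _ := Zmodule_isRng.Build contracted cmulDl cmulDr.

Lemma contr_scaleE a (g : RS) : a *: pi g = pi (a *: g).
Proof. by rewrite pi_contrZ. Qed.

Lemma contr_mulE (g h : RS) : (pi g * pi h)%g = pi (g * h)%g.
Proof. by rewrite pi_contrM. Qed.

Lemma contr_scaleAl a (x y : contracted) : a *: (x * y)%g = ((a *: x) * y)%g.
Proof.
elim/contrW: x => g; elim/contrW: y => h.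
rewrite contr_mulE !contr_scaleE contr_mulE; congr pi; exact: sgscaleAl.
Qed.

Lemma contr_scaleAr a (x y : contracted) : a *: (x * y)%g = (x * (a *: y))%g.
Proof.
elim/contrW: x => g; elim/contrW: y => h.
rewrite contr_mulE !contr_scaleE contr_mulE; congr pi; exact: sgscaleAr.
Qed.

Definition contr_elt (s : S) : contracted := pi << s >>.

Lemma contr_elt0 : contr_elt szero = 0.
Proof.
by rewrite -pi_contr0; apply/pi_contrP/zero_idealP; exists 1; rewrite subr0.
Qed.

Lemma contr_eltM (s t : S) : contr_elt (s * t)%g = (contr_elt s * contr_elt t)%g.
Proof. by rewrite -[RHS]pi_contrM [X in pi X]sgmulUU mulr1. Qed.

Lemma contrE (x : contracted) : exists g : RS,
  g@_szero = 0 /\ x = \sum_(s <- msupp g) g@_s *: contr_elt s.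
Proof.
have pi_sum (h : RS) : pi h = \sum_(s <- msupp h) h@_s *: contr_elt s.
  rewrite {1}[h]monalgE (big_morph pi pi_contrD pi_contr0); apply: eq_bigr => s _.
  by rewrite -[RHS]pi_contrZ sgscaleU mulr1.
exists (repr x - << (repr x)@_z *g z >>); split.
  by rewrite mcoeffB mcoeffUU subrr.
rewrite -pi_sum -[LHS]reprK; apply/pi_contrP/zero_idealP.
by exists (repr x)@_z; rewrite opprB addrC subrK.
Qed.

Lemma contr_elt_inj : injective contr_elt.
Proof.
move=> s t /pi_contrP/zero_idealP[x e].
case: (eqVneq s t) => // st.
move: (congr1 (mcoeff s) e) (congr1 (mcoeff t) e).
rewrite !mcoeffB !mcoeffU !eqxx (eq_sym t s) (negbTE st) subr0 sub0r.
have [<-|zs] := eqVneq z s; last by move=> /eqP; rewrite mulr0n oner_eq0.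
have [//|zt] := eqVneq z t; move=> _ /eqP.
by rewrite mulr0n oppr_eq0 oner_eq0.
Qed.
End Contracted.

(* Main.v *)
Require Import Defs.
From mathcomp Require Import all_boot all_order all_algebra.
From HB Require Import structures.
From mathcomp Require Import finmap boolp.
From mathcomp.multinomials Require Import monalg.
From Stdlib Require Import Relation_Operators.

(** By bilinearity of the product, a linear map on the contracted semigroup ring
    is a trace as soon as it identifies [st] with [ts] for [s], [t] in [S], and
    these pairs are what generates [conj_p]. This gives the first part
    ([is_trace_conj_p]).

    For the second part, minimality turns [f s = f t] into the statement that
    [s - t] is a sum of commutators, so it is enough to separate non-conjugate
    elements by some trace ([sum_of_commutators_conj_p]). When [s] is not
    conjugate to the zero of [S], the indicator function of its conjugacy class
    vanishes at zero, hence extends to a linear map on the contracted ring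
    ([contr_lift]); by the first part this extension is a trace. It kills sums of
    commutators and takes the value 1 at [s], so it must be nonzero at [t], that
    is, [t] is conjugate to [s]. *)

Set Implicit Arguments.
Unset Strict Implicit.
Unset Printing Implicit Defensive.

Import GRing.Theory.
Local Open Scope fset_scope.
Local Open Scope ring_scope.

Section ConjugacyTheory.
Variable S : semigroupType.

Lemma conj_p_mulC (s t : S) : conj_p (s * t)%g (t * s)%g.
Proof. by apply: t_step; exists (Some s), (Some t); split. Qed.

(** Any [s] is [s 1], but the identity lies either in [S] or outside it
    according to whether [S] is already a monoid, which calls for excluded
    middle. *)
Lemma conj_p_refl (s : S) : conj_p s s.
Proof.
apply: t_step; case: (EM (has_identity S)) => [[e eP]|no1].
  by exists (Some s), (Some e); case: (eP s) => es se; split; rewrite //= ?es ?se.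
by exists (Some s), None; split.
Qed.

Lemma conj_p_sym (s t : S) : conj_p s t -> conj_p t s.
Proof.
elim=> [x y [p [r [p1 r1 xE yE]]]|x y z _ yx _ zy]; last exact: t_trans zy yx.
by apply: t_step; exists r, p; split.
Qed.

Lemma conj_p_eq (X : Type) (g : S -> X) :
  (forall s t : S, g (s * t)%g = g (t * s)%g) ->
  forall s t : S, conj_p s t -> g s = g t.
Proof.
move=> gC s t; elim=> [x y|x y z _ -> _ ->] //.
by case=> [[p|] [[r|] [_ _ /= xE yE]]] //; case: xE yE => -> [->].
Qed.

End ConjugacyTheory.

Section RngTheory.
Variable A : rngType.

Lemma rng_mul0 (x : A) : (0 * x)%g = 0.
Proof. by apply: (addIr (0 * x)%g); rewrite -rngDl !add0r. Qed.

Lemma rng_mulr0 (x : A) : (x * 0)%g = 0.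
Proof. by apply: (addIr (x * 0)%g); rewrite -rngDr !add0r. Qed.

End RngTheory.

Lemma trace_sum_of_commutators (A : rngType) (T : zmodType)
    (f : {additive A -> T}) (x : A) :
  is_trace f -> sum_of_commutators x -> f x = 0.
Proof.
move=> ftr [s ->]; rewrite raddf_sum big1 // => p _.
by rewrite raddfB /= ftr subrr.
Qed.

Section ContractedTraces.
Variables (R : comNzRingType) (S : semigroup0Type).

Lemma contr_span_ind (P : contracted R S -> Prop) :
  P 0 -> (forall a s x, P x -> P (a *: contr_elt R s + x)) -> forall x, P x.
Proof.
move=> P0 PD x; have [g [_ ->]] := contrE x.
by elim: (enum_fset (msupp g)) => [|s r IHr]; rewrite ?big_nil // big_cons; apply: PD.
Qed.

Lemma is_trace_mulC (V : lmodType R) (f : {linear contracted R S -> V}) :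
  (forall s t : S, f (contr_elt R (s * t)%g) = f (contr_elt R (t * s)%g)) ->
  is_trace f.
Proof.
move=> fC; elim/contr_span_ind=> [|a s x IHx] y.
  by rewrite rng_mul0 rng_mulr0.
rewrite rngDl rngDr !raddfD /= IHx; congr (_ + _).
rewrite -contr_scaleAl -contr_scaleAr !linearZ /=; congr (_ *: _).
elim/contr_span_ind: y => [|b t y IHy]; first by rewrite rng_mul0 rng_mulr0.
rewrite rngDl rngDr !raddfD /= IHy; congr (_ + _).
by rewrite -contr_scaleAl -contr_scaleAr !linearZ /= -!contr_eltM fC.
Qed.

Lemma is_trace_conj_p (V : lmodType R) (f : {linear contracted R S -> V}) :
  is_trace f <->
  forall s t : S, conj_p s t -> f (contr_elt R s) = f (contr_elt R t).
Proof.
split=> [ftr|fconj]; last by apply: is_trace_mulC => s t; exact/fconj/conj_p_mulC.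
apply: (conj_p_eq (g := fun s => f (contr_elt R s))) => s t.
by rewrite !contr_eltM ftr.
Qed.

(** Universal property of the contracted semigroup ring as a module: it is free
    on the nonzero elements of [S]. *)
Lemma contr_lift (V : lmodType R) (phi : S -> V) : phi szero = 0 ->
  exists f : {linear contracted R S -> V}, forall s, f (contr_elt R s) = phi s.
Proof.
move=> phi0.
pose E (g : {malg R[S]}) : V := \sum_(s <- msupp g) g@_s *: phi s.
have Ew (d : {fset S}) g : msupp g `<=` d -> E g = \sum_(s <- d) g@_s *: phi s.
  move=> gd; rewrite /E (big_fset_incl _ gd) // => s _ /mcoeff_outdom ->.
  by rewrite scale0r.
have EL a g h : E (a *: g + h) = a *: E g + E h.
  pose d := msupp g `|` msupp h `|` msupp (a *: g + h).
  have gd : msupp g `<=` d by rewrite /d -fsetUA fsubsetUl.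
  have hd : msupp h `<=` d by rewrite /d (fsetUC (msupp g)) -fsetUA fsubsetUl.
  rewrite (Ew d) ?fsubsetUr // (Ew d g) // (Ew d h) // scaler_sumr -big_split /=.
  by apply: eq_bigr => s _; rewrite mcoeffD mcoeffZ scalerDl scalerA.
have EU b s : E << b *g s >> = b *: phi s.
  by rewrite (Ew [fset s]) ?msuppU_le // big_seq_fset1 mcoeffUU.
have Epi (g h : sgring R S) : \pi_(contracted R S)%qT g = \pi_(contracted R S)%qT h ->
    E g = E h.
  move=> /pi_contrP/zero_idealP[b gh].
  rewrite -[g](subrK h) gh -[<< _ *g _ >>]scale1r EL EU phi0.
  by rewrite !scaler0 add0r.
have ErL : linear (fun x : contracted R S => E (repr x)).
  move=> a x y /=; rewrite -EL; apply: Epi.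
  by rewrite pi_contrD pi_contrZ !reprK.
pose ErM := GRing.isLinear.Build _ _ _ _ _ ErL.
pose f : {linear contracted R S -> V} := HB.pack (fun x => E (repr x)) ErM.
exists f => s; rewrite /f /= -[RHS]scale1r -EU; apply: Epi.
by rewrite reprK.
Qed.

Lemma sum_of_commutators_conj_p (s t : S) :
  sum_of_commutators (contr_elt R s - contr_elt R t) -> conj_p s t.
Proof.
move=> st.
(* The indicator of a class extends only if the class avoids zero; conjugacy to
   zero itself is read off from the indicators of all the other classes. *)
have sep u : ~ conj_p u szero -> conj_p u s <-> conj_p u t.
  move=> u0; pose chi v : R^o := if `[< conj_p u v >] then 1 else 0.
  have chiT v : conj_p u v -> chi v = 1 by move=> uv; rewrite /chi asboolT.
  have chiF v : ~ conj_p u v -> chi v = 0 by move=> uv; rewrite /chi asboolF.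
  have [f fE] := contr_lift (chiF _ u0).
  have ftr : is_trace f.
    apply/is_trace_conj_p => v w vw; rewrite !fE /chi.
    suff -> : conj_p u v = conj_p u w by [].
    apply/propext; split=> uv; first exact: t_trans uv vw.
    exact: t_trans uv (conj_p_sym vw).
  have := trace_sum_of_commutators ftr st.
  rewrite raddfB /= !fE => /eqP; rewrite subr_eq0 => /eqP chi_st.
  split=> uv; apply: contrapT => /chiF uw; move: chi_st;
    by rewrite uw (chiT _ uv) => /eqP; rewrite ?oner_eq0 // eq_sym oner_eq0.
have [s0|/sep ss] := EM (conj_p s szero); last exact/ss/conj_p_refl.
have [t0|/sep tt] := EM (conj_p t szero); last exact/conj_p_sym/tt/conj_p_refl.
exact: t_trans s0 (conj_p_sym t0).
Qed.

End ContractedTraces.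

Theorem proposition43 (R : comNzRingType) (T : algType R) (S : semigroup0Type)
    (f : {linear contracted R S -> T}) :
  (is_trace f <->
     forall s t : S, conj_p s t -> f (contr_elt R s) = f (contr_elt R t))
  /\
  (is_minimal_trace f ->
     forall s t : S, conj_p s t <-> f (contr_elt R s) = f (contr_elt R t)).
Proof.
split=> [|[ftr fmin] s t]; first exact: is_trace_conj_p.
split=> [|fst]; first by move: s t; apply/is_trace_conj_p.
by apply/(@sum_of_commutators_conj_p R)/fmin; rewrite raddfB /= fst subrr.
Qed.
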